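(* Let $E$ and $B$ be finite $T_0$-spaces with $E\neq\varnothing$ and let $p\colon E\to B$ be a Hurewicz fibration. Then the smallest dbp-retract of $p$ is a Grothendieck bifibration.
   Context: A finite $T_0$-space $X$ is regarded as a poset via $x\leq y$ iff $U_x\subseteq U_y$, where $U_a$ is the smallest open set containing $a$; a poset is regarded as a small category (with one arrow $x\to y$ exactly when $x\leq y$), and continuous (i.e. order-preserving) maps as functors. A point $a\in X$ is a down beat point of $X$ if $\{x: x<a\}$ has a maximum element. For a continuous map $p\colon E\to B$ between finite $T_0$-spaces, $e\in E$ is a down beat point of $p$ if it is a down beat point of both $E$ and the fiber $p^{-1}(p(e))$; removing it means replacing $p$ by its restriction $E-\{e\}\to B$. A dbp-retract of $p$ is a restriction $p'\colon E'\to B$ of $p$ obtained by successively removing (finitely many, possibly zero) down beat points, each being a down beat point of the map at that stage. The set of dbp-retracts of $p$ is partially ordered by: $x\leq y$ iff $x$ is a dbp-retract of $y$. This poset has a minimum element, called the smallest dbp-retract of $p$. A Hurewicz fibration is a continuous map with the homotopy lifting property with respect to all topological spaces. A functor $p\colon E\to B$ between small categories is a Grothendieck fibration if for all $e\in E$ and all arrows $f\colon b\to p(e)$ of $B$ there is a cartesian arrow $\tilde f\colon e'\to e$ of $E$ with $p(\tilde f)=f$; here an arrow $f\colon e'\to e$ is cartesian if for all $g\colon e''\to e$ in $E$ and $h\colon p(e'')\to p(e')$ in $B$ with $p(g)=p(f)h$ there is a unique $\tilde h\colon e''\to e'$ with $f\tilde h=g$ and $p(\tilde h)=h$. It is a Grothendieck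 opfibration if $p^{\mathrm{op}}$ is a Grothendieck fibration, and a Grothendieck bifibration if it is both. *)

(* Defs.v *)
From HB Require Import structures.
From mathcomp Require Import all_boot all_order all_algebra.
From mathcomp Require Import all_classical all_reals all_analysis.

Set Implicit Arguments.
Unset Strict Implicit.
Unset Printing Implicit Defensive.

Import Order.TTheory GRing.Theory Num.Theory.
Import numFieldNormedType.Exports.

Local Open Scope classical_set_scope.
Local Open Scope ring_scope.

Record category := Category {
  ob :> Type;
  hom : ob -> ob -> Type;
  idc : forall x, hom x x;
  compc : forall x y z, hom y z -> hom x y -> hom x z;
  comp1c : forall x y (f : hom x y), compc (idc y) f = f;
  compc1 : forall x y (f : hom x y), compc f (idc x) = f;
  compcA : forall x y z t (f : hom z t) (g : hom y z) (h : hom x y),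
    compc f (compc g h) = compc (compc f g) h }.

Arguments hom {c} x y.
Arguments idc {c} x.
Arguments compc {c x y z} f g.

Record functor (C D : category) := Functor {
  fob :> C -> D;
  fmap : forall x y : C, hom x y -> hom (fob x) (fob y);
  fmap1 : forall x : C, fmap (idc x) = idc (fob x);
  fmapc : forall (x y z : C) (f : hom y z) (g : hom x y),
    fmap (compc f g) = compc (fmap f) (fmap g) }.

Arguments fmap {C D} _ {x y} _.

Definition op (C : category) : category :=
  @Category C (fun x y => hom y x) (fun x => idc x)
    (fun x y z f g => compc g f)
    (fun x y f => compc1 f) (fun x y f => comp1c f)
    (fun x y z t f g h => esym (compcA h g f)).

Definition op_functor (C D : category) (F : functor C D) :
    functor (op C) (op D) :=
  @Functor (op C) (op D) F (fun x y f => fmap F f)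
    (fun x => fmap1 F x) (fun x y z f g => fmapc F g f).

Definition cartesian (E B : category) (p : functor E B) (e' e : E)
    (f : hom e' e) : Prop :=
  forall (e'' : E) (g : hom e'' e) (h : hom (p e'') (p e')),
    fmap p g = compc (fmap p f) h ->
    exists! k : hom e'' e', compc f k = g /\ fmap p k = h.

(* The equation [p(f') = f] relates arrows whose sources [p e'] and [b] are
   only propositionally equal; it is stated in the type of all arrows with
   target [p e], so that it includes [p e' = b]. *)
Definition grothendieck_fibration (E B : category) (p : functor E B) : Prop :=
  forall (e : E) (b : B) (f : hom b (p e)),
    exists (e' : E) (f' : hom e' e),
      cartesian p f' /\
      existT (fun x : B => hom x (p e)) (p e') (fmap p f') = existT _ b f.

Definition grothendieck_opfibration (E B : category) (p : functor E B) : Prop :=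
  grothendieck_fibration (op_functor p).

Definition grothendieck_bifibration (E B : category) (p : functor E B) : Prop :=
  grothendieck_fibration p /\ grothendieck_opfibration p.

(* In a finite space this intersection is open, hence it is the smallest open
   set containing [a]. *)
Definition min_open (X : topologicalType) (a : X) : set X :=
  \bigcap_(U in [set U : set X | open U /\ U a]) U.

Definition spec_le (X : topologicalType) (x y : X) : Prop :=
  min_open x `<=` min_open y.

Definition spec_lt (X : topologicalType) (x y : X) : Prop :=
  spec_le x y /\ x <> y.

Lemma spec_le_refl (X : topologicalType) (x : X) : spec_le x x.
Proof. by []. Qed.

Lemma spec_le_trans (X : topologicalType) (x y z : X) :
  spec_le y z -> spec_le x y -> spec_le x z.
Proof. by move=> yz xy t /xy /yz. Qed.

Lemma spec_le_continuous (X Y : topologicalType) (f : X -> Y) :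
  continuous f -> forall x y, spec_le x y -> spec_le (f x) (f y).
Proof.
move=> /continuousP cf x y xy t fxt U [oU Ufy].
have yx : min_open y x by apply: xy => V [].
by apply: fxt; split=> //; apply: (yx (f @^-1` U)); split=> //; exact: cf.
Qed.

(* Arrows are proofs of [x <= y], so there is at most one by proof
   irrelevance. *)
Definition space_category (X : topologicalType) : category :=
  @Category X (@spec_le X) (@spec_le_refl X) (@spec_le_trans X)
    (fun _ _ _ => Prop_irrelevance _ _) (fun _ _ _ => Prop_irrelevance _ _)
    (fun _ _ _ _ _ _ _ => Prop_irrelevance _ _).

Definition map_functor (X Y : topologicalType) (f : X -> Y)
    (cf : continuous f) : functor (space_category X) (space_category Y) :=
  @Functor (space_category X) (space_category Y) f
    (spec_le_continuous cf)
    (fun x => @Prop_irrelevance (spec_le (f x) (f x)) _ _)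
    (fun x _ z _ _ => @Prop_irrelevance (spec_le (f x) (f z)) _ _).

Definition down_beat_point (X : topologicalType) (a : X) : Prop :=
  exists2 m : X, spec_lt m a & forall x : X, spec_lt x a -> spec_le x m.

Definition fiber (E B : Type) (p : E -> B) (b : B) : set E := p @^-1` [set b].

Definition in_fiber (E B : Type) (p : E -> B) (e : E) : fiber p (p e) :=
  exist _ e (mem_set (erefl (p e))).

(* A set used as a type carries the subspace topology. *)
Definition map_down_beat_point (E : topologicalType) (B : Type) (p : E -> B)
    (e : E) : Prop :=
  down_beat_point e /\ down_beat_point (in_fiber p e).

(* A restriction of [p] is represented by its domain, a subset of [E]:
   [dbp_retract p A A'] says that the restriction of [p] to [A'] is a
   dbp-retract of the restriction [sigL A p] of [p] to the subspace [A]. *)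
Inductive dbp_retract (E : topologicalType) (B : Type) (p : E -> B) :
    set E -> set E -> Prop :=
| dbp_retract_refl (A : set E) : dbp_retract p A A
| dbp_retract_remove (A A' : set E) (a : A) :
    map_down_beat_point (sigL A p) a ->
    dbp_retract p (A `\ set_val a) A' ->
    dbp_retract p A A'.

Definition smallest_dbp_retract (E : topologicalType) (B : Type) (p : E -> B)
    (A : set E) : Prop :=
  dbp_retract p [set: E] A /\
  forall A' : set E, dbp_retract p [set: E] A' -> dbp_retract p A' A.

Lemma sigL_continuous (E B : topologicalType) (p : E -> B) (A : set E) :
  continuous p -> continuous (sigL A p).
Proof.
move=> cp x; apply: (@continuous_comp A E B set_val p); last exact: cp.
exact: (@initial_continuous A E set_val).
Qed.
Arguments sigL_continuous {E B p} A _.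

Definition unit_interval (R : realType) : set R := `[0, 1].
Arguments unit_interval R : clear implicits.

Lemma unit_interval0 (R : realType) : (0 : R) \in unit_interval R.
Proof. by rewrite inE /unit_interval /= in_itv /= lexx ler01. Qed.

Definition ui0 (R : realType) : unit_interval R :=
  exist _ 0 (unit_interval0 R).

Record hurewicz_fibration (R : realType) (E B : topologicalType) (p : E -> B) :
    Prop := HurewiczFibration {
  hurewicz_continuous : continuous p;
  hurewicz_lifting :
    forall (X : topologicalType) (h : X -> E) (H : X * unit_interval R -> B),
      continuous h -> continuous H ->
      (forall x, H (x, ui0 R) = p (h x)) ->
      exists G : X * unit_interval R -> E,
        [/\ continuous G, forall x, G (x, ui0 R) = h x
          & forall z, p (G z) = H z] }.

(* Main.v *)
(** A lift of a homotopy of finite T0-spaces is monotone in the point and, near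
    time 0, lies below its initial value. If [p] has no down beat points, a
    monotone self-map of [E] over [B] lying below the identity is the identity;
    so a lift of the constant homotopy of [E] stays the identity on some
    [[0, d[]. Attach to [E] extra points [k] starting at [e], with a down-set
    [dn] of [E] below and an up-set [up] above them: for [t < d], the lift at [k]
    is squeezed between [dn] and [up].
    For a cartesian lift of [b <= p e], attach one point whose path jumps from
    [p e] to [b] right after time 0; [dn] consists of the [x <= e] over the
    elements below [b]. For an opcartesian lift of [p e <= b], attach one point
    for each real [s > 0], whose path jumps from [p e] to [b] at time [s]; [up]
    consists of the [x >= e] over the elements above [b]. Since [d] comes from
    [E] alone, [s] may be chosen smaller than [d], and the lift at time [s] is
    the required minimum.
    Finally, removing down beat points of [p] is strongly confluent, so the
    terminal dbp-retract is the smallest one, and it is a fibrewise retract of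
    [p], hence still a Hurewicz fibration. *)
From HB Require Import structures.
From Stdlib Require Wf_nat Wellfounded.
Require Import Defs.
From mathcomp Require Import all_boot all_order all_algebra finmap.
From mathcomp Require Import all_classical all_reals all_analysis.

Set Implicit Arguments.
Unset Strict Implicit.
Unset Printing Implicit Defensive.

Import Order.TTheory GRing.Theory Num.Theory.
Import numFieldNormedType.Exports.

Local Open Scope fset_scope.
Local Open Scope classical_set_scope.

(** * Finite T0-spaces and their specialization order *)

Lemma filter_finite_forall (T I : choiceType) (F : set_system T)
    (P : I -> set T) :
  finite_set [set: I] -> Filter F -> (forall i, F (P i)) ->
  F [set t | forall i, P i t].
Proof.
move=> /finite_fsetP[D DE] FF FP.
apply: filterS (@filter_bigI T I D P F FF (fun i _ => FP i)) => t Pt i.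
by apply: Pt; have : [set: I] i by []; rewrite DE.
Qed.

Lemma spec_leP (X : topologicalType) (x y : X) :
  spec_le x y <-> forall U : set X, open U -> U y -> U x.
Proof.
split=> [xy U oU Uy|xy t tx U [oU Uy]]; last first.
  by apply: tx; split=> //; exact: xy.
by apply: (xy x _ U) => [V []|].
Qed.

Lemma spec_le_open (X : topologicalType) (x y : X) (U : set X) :
  spec_le x y -> open U -> U y -> U x.
Proof. by move=> /spec_leP; exact. Qed.

Lemma spec_le_anti (X : topologicalType) (x y : X) :
  kolmogorov_space X -> spec_le x y -> spec_le y x -> x = y.
Proof.
move=> T0 xy yx; apply: contrapT => /eqP /T0[A].
rewrite !inE !nbhsE => -[[[U [oU Ux] UA] nAy]|[[U [oU Uy] UA] nAx]].
- by apply/nAy/UA; exact: spec_le_open yx oU Ux.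
- by apply/nAx/UA; exact: spec_le_open xy oU Uy.
Qed.

(** Each of the finitely many points not below [a] is missed by some neighbourhood of [a]; intersect
    these. *)
Lemma nbhs_spec_le (X : topologicalType) (a : X) :
  finite_set [set: X] -> nbhs a [set x | spec_le x a].
Proof.
move=> finX.
have H (y : X) : nbhs a [set t | ~ spec_le y a -> t <> y].
  have [ya|] := pselect (spec_le y a); first by apply: filterE => t [].
  move=> /spec_leP/existsNP[U /not_implyP[oU /not_implyP[Ua nUy]]].
  apply: (@filterS _ _ _ U); last exact: open_nbhs_nbhs.
  by move=> t Ut _ ty; apply: nUy; rewrite -ty.
apply: filterS (filter_finite_forall finX _ H) => t /= /(_ t).
by move=> h; apply: contrapT => /h.
Qed.

Lemma homo_spec_continuous (X Y : topologicalType) (f : X -> Y) :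
  finite_set [set: X] -> {homo f : x y / spec_le x y} -> continuous f.
Proof.
move=> finX fmono a O; rewrite nbhsE => -[U [oU Ufa] UO].
apply: filterS (nbhs_spec_le a finX) => x /= xa.
by apply/UO/(spec_le_open _ oU Ufa); exact: fmono.
Qed.

Lemma set_val_nbhs (X : topologicalType) (A : set X) (a : A) (U : set A) :
  nbhs a U <-> exists2 V, nbhs (set_val a) V & set_val @^-1` V `<=` U.
Proof.
split=> [|[V Va VU]]; last first.
  by apply: filterS VU _; exact: (@initial_continuous A X set_val a).
rewrite nbhsE => -[_ [[V oV <-] Va] VU]; exists V => //.
by exists V.
Qed.

Lemma set_val_spec_le (X : topologicalType) (A : set X) (a b : A) :
  spec_le (set_val a) (set_val b) <-> spec_le a b.
Proof.
split=> ab.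
  by apply/spec_leP => _ [V oV <-] /= /(spec_le_open ab); exact.
exact: (@spec_le_continuous A X set_val (@initial_continuous A X set_val)).
Qed.

Lemma continuous_set_val (X Y : topologicalType) (A : set Y) (f : X -> A) :
  continuous (fun x => set_val (f x)) -> continuous f.
Proof.
move=> cf x U /set_val_nbhs[V Vfx VU].
by apply: (@filterS _ _ _ ((set_val \o f) @^-1` V)) (cf x _ Vfx) => t /VU.
Qed.


Lemma finite_set_type (X : Type) (A : set X) :
  finite_set [set: X] -> finite_set [set: A].
Proof.
move=> finX; rewrite -(preimage_setT (set_val : A -> X)).
by apply: finite_preimage => // x y _ _; exact: val_inj.
Qed.

Lemma kolmogorov_space_set_type (X : topologicalType) (A : set X) :
  kolmogorov_space X -> kolmogorov_space A.
Proof.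
move=> T0X a b /eqP ab.
have /T0X[U] : set_val a != set_val b by apply/eqP => /val_inj.
rewrite !inE => U_ab; exists (set_val @^-1` U); rewrite !inE.
by case: U_ab => -[Ux Uy]; [left|right]; split=> //; apply/set_val_nbhs;
  exists U.
Qed.

Lemma properset_wf (T : choiceType) :
  finite_set [set: T] -> well_founded (fun A B : set T => A `<` B).
Proof.
move=> finT; have fin (A : set T) : finite_set A by exact: sub_finite_set finT.
apply: (@Wf_nat.well_founded_lt_compat _ (fun A => #|` fset_set A|)).
move=> A B [AB BA]; apply/ssrnat.ltP/fproper_ltn_card.
by rewrite fproperE; apply/andP; split; last apply/negP; rewrite -fset_set_sub.
Qed.

Lemma spec_lt_wf (X : topologicalType) :
  finite_set [set: X] -> kolmogorov_space X -> well_founded (@spec_lt X).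
Proof.
move=> finX T0X; pose L (x : X) := [set y | spec_le y x].
apply: (Inclusion.wf_incl _ _ (fun x y => L x `<` L y)).
  move=> x y [xy xNy]; split=> [z zx|/(_ y (@spec_le_refl _ y)) yx].
    exact: spec_le_trans xy zx.
  by apply: xNy; exact: spec_le_anti.
exact: (Inverse_Image.wf_inverse_image _ _ _ L (properset_wf finX)).
Qed.

(** The maximum [m] below [e] in [E] already lies in the fiber: a fiber point [m'] below [e]
    satisfies [m' <= m <= e], so [p e <= p m <= p e]. *)
Lemma map_down_beat_pointP (E B : topologicalType) (p : E -> B) (e : E) :
  kolmogorov_space B -> {homo p : x y / spec_le x y} ->
  map_down_beat_point p e <->
  exists2 m, spec_lt m e /\ p m = p e & forall x, spec_lt x e -> spec_le x m.
Proof.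
move=> T0B pmono; split=> [[[m [me mNe] em] [m' [m'e m'Ne] _]]|].
- exists m => //; split=> //; apply: spec_le_anti => //; first exact: pmono.
  move: m'e m'Ne => /set_val_spec_le/= m'e m'Ne.
  have /pmono : spec_le (set_val m') m.
    by apply: em; split=> // m'E; apply: m'Ne; exact: val_inj.
  by have /set_mem/= -> := valP m'.
- move=> [m [[me mNe] pme] em]; split; first by exists m.
  exists (exist _ m (mem_set pme) : fiber p (p e)).
    by split; [exact/set_val_spec_le | move=> /(congr1 set_val)].
  move=> x [/set_val_spec_le xe xNe]; apply/set_val_spec_le; apply: em.
  by split=> // xE; apply: xNe; exact: val_inj.
Qed.

(** * Successive removal of down beat points of a map *)

Section DbpRetracts.
Variables (E B : topologicalType) (p : E -> B).
Hypotheses (T0E : kolmogorov_space E) (T0B : kolmogorov_space B).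
Hypothesis cp : continuous p.

(** Stated with points of [E], so that successive removals never involve nested subspace types. *)
Definition removable (A : set E) (e : E) : Prop :=
  A e /\ exists2 m, [/\ A m, spec_lt m e & p m = p e] &
                    forall x, A x -> spec_lt x e -> spec_le x m.

Lemma removableP (A : set E) (a : A) :
  map_down_beat_point (sigL A p) a <-> removable A (set_val a).
Proof.
have cA := @sigL_continuous _ _ p A cp.
split=> [/(map_down_beat_pointP _ T0B (spec_le_continuous cA))|].
  move=> [m [[/set_val_spec_le ma mNa] pma] am]; split; first exact: set_valP.
  exists (set_val m).
    by split=> //; [exact: set_valP | split=> // /val_inj].
  move=> x Ax [xa xNa].
  suff : spec_le (exist _ x (mem_set Ax) : A) m by move/set_val_spec_le.
  by apply: am; split; [exact/set_val_spec_le | move=> /(congr1 set_val)].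
move=> [_ [m [Am [ma mNa] pma] am]].
apply/(map_down_beat_pointP _ T0B (spec_le_continuous cA)).
exists (exist _ m (mem_set Am) : A).
  split=> //; split; first exact/set_val_spec_le.
  by move=> /(congr1 set_val).
move=> x [/set_val_spec_le xa xNa]; apply/set_val_spec_le; apply: am => //.
  exact: set_valP.
by split=> // xE; apply: xNa; exact: val_inj.
Qed.

Lemma removable_retract (A A' : set E) (e : E) :
  removable A e -> dbp_retract p (A `\ e) A' -> dbp_retract p A A'.
Proof.
move=> re; have Ae := re.1.
apply: (@dbp_retract_remove _ _ _ _ _ (exist _ e (mem_set Ae) : A)).
exact/removableP.
Qed.

(** The maximum below [e'] survives unless it is [e]; in that case the maximum below [e] takes
    over. *)
Lemma removable_setD1 (A : set E) (e e' : E) :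
  removable A e -> removable A e' -> e <> e' -> removable (A `\ e) e'.
Proof.
move=> [Ae [m [Am [me mNe] pme] em]] [Ae' [m' [Am' [me' mNe'] pme'] em']] eNe'.
split; first by split=> // /esym.
have [m'E|m'Ne] := pselect (m' = e); last first.
  by exists m' => // x [Ax _]; exact: em'.
rewrite m'E in me' mNe' pme'; exists m; last first.
  move=> x [Ax xNe] xe'; apply: em => //; split=> //.
  by rewrite -m'E; exact: em'.
split; [by split| |by rewrite pme].
split; first exact: spec_le_trans me' me.
by move=> mE; apply: eNe'; apply: spec_le_anti => //; rewrite -mE.
Qed.

(** As [C] has no removable point, [e] must be removed at some stage; since removals commute, that
    stage can be moved to the front. *)
Lemma dbp_retract_setD1 (A C : set E) (e : E) :
  (forall x, ~ removable C x) -> removable A e ->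
  dbp_retract p A C -> dbp_retract p (A `\ e) C.
Proof.
move=> nC + dC; elim: dC nC e => {A C} [A nA e /nA//|A C a ra dC IH nC e re].
move/removableP in ra.
have [<-//|aNe] := pselect (set_val a = e).
apply: (@removable_retract _ _ (set_val a)).
  by apply: removable_setD1 => // /esym.
by rewrite setDDl setUC -setDDl; apply: IH => //; exact: removable_setD1.
Qed.

Lemma dbp_retract_confluent (A A' C : set E) :
  (forall x, ~ removable C x) ->
  dbp_retract p A A' -> dbp_retract p A C -> dbp_retract p A' C.
Proof.
move=> nC; elim=> // {}A {}A' a ra _ IH dC; apply: IH.
by apply: dbp_retract_setD1 => //; exact/removableP.
Qed.

Lemma exists_dbp_retract_irremovable (A : set E) : finite_set [set: E] ->
  exists2 C, dbp_retract p A C & forall x, ~ removable C x.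
Proof.
move=> finE; elim/(well_founded_ind (properset_wf finE)): A => A IH.
have [[e re]|nA] := pselect (exists e, removable A e); last first.
  by exists A; [exact: dbp_retract_refl | move=> x rx; apply: nA; exists x].
have [|C dC nC] := IH (A `\ e).
  by split=> [x []//|/(_ e re.1)[_]]; exact.
by exists C => //; exact: removable_retract re dC.
Qed.

Lemma dbp_retract_retraction (A A' : set E) : dbp_retract p A A' ->
  A' `<=` A /\ exists r : E -> E,
    [/\ forall x, A x -> A' (r x), forall x, A' x -> r x = x,
        forall x, A x -> p (r x) = p x
      & forall x y, A x -> A y -> spec_le x y -> spec_le (r x) (r y)].
Proof.
elim=> {A A'} [A|A A' a /removableP].
  by split=> //; exists id.
move: (set_val a) => {}a [Aa [m [Am [ma mNa] pma] am]] _.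
move=> [A'A [r [rA rid pr rmono]]].
(* One removal is undone by sending [a] to the maximum below it, which lies in the same fiber. *)
pose f x := if pselect (x = a) then m else x.
have fA x : A x -> (A `\ a) (f x) by rewrite /f; case: pselect.
split=> [x /A'A[]//|]; exists (r \o f).
split=> /= [x Ax|x A'x|x Ax|x y Ax Ay xy].
- exact/rA/fA.
- by have [_ xNa] := A'A _ A'x; rewrite /f; case: pselect => //= _; exact: rid.
- by rewrite pr; [rewrite /f; case: pselect => //= -> | exact: fA].
- apply: rmono; [exact: fA|exact: fA|]; rewrite /f.
  case: pselect => [xa|xNa]; case: pselect => [ya|yNa] //.
    by apply: spec_le_trans ma; rewrite -xa.
  by apply: am => //; split=> //; rewrite -ya.
Qed.

End DbpRetracts.

(** * Fibrewise retracts, and rigidity of maps without down beat points *)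

Lemma hurewicz_fibration_sigL (R : realType) (E B : topologicalType)
    (p : E -> B) (A : set E) (r : E -> E) :
  continuous r -> (forall x, A (r x)) -> (forall x, A x -> r x = x) ->
  (forall x, p (r x) = p x) ->
  hurewicz_fibration R p -> hurewicz_fibration R (sigL A p).
Proof.
move=> cr rA rid pr [cp lift]; split; first exact: sigL_continuous.
move=> X h H ch cH Hh.
have [|G [cG Gh pG]] := lift X (set_val \o h) H _ cH Hh.
  by move=> x; apply: continuous_comp; [exact: ch|exact: initial_continuous].
(* A lift in [E] is pushed into [A] by [r], which preserves the fibers. *)
exists (fun z => exist _ (r (G z)) (mem_set (rA (G z)))); split.
- apply: continuous_set_val => z /=.
  by apply: (@continuous_comp _ _ _ G r); [exact: cG|exact: cr].
- move=> x; apply: val_inj => /=; rewrite Gh/= rid //; exact: set_valP.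
- by move=> z; rewrite -pG -pr.
Qed.

Definition irremovable_map (E B : topologicalType) (p : E -> B) : Prop :=
  forall e, ~ map_down_beat_point p e.

(** If [f] fixes every [y < x] but not [x], then [y = f y <= f x < x], so [f x] is the maximum below
    [x] and [x] is a down beat point of [p]. *)
Lemma irremovable_map_rigid (E B : topologicalType) (p : E -> B) (f : E -> E) :
  finite_set [set: E] -> kolmogorov_space E -> kolmogorov_space B ->
  {homo p : x y / spec_le x y} -> irremovable_map p ->
  {homo f : x y / spec_le x y} -> (forall x, spec_le (f x) x) ->
  (forall x, p (f x) = p x) -> f =1 id.
Proof.
move=> finE T0E T0B pmono np fmono fle pf.
elim/(well_founded_ind (spec_lt_wf finE T0E)) => x IH.
apply: contrapT => fxNx; apply: (np x).
apply/map_down_beat_pointP => //; exists (f x); first by split.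
by move=> y yx; rewrite -(IH y yx); apply: fmono; case: yx.
Qed.

(* The open sets are the down-sets of [le], which need not be a preorder. *)
Definition preorder_space (T : choiceType) (le : T -> T -> Prop) : Type := T.

(** * Topologies of down-sets, and paths with one jump *)

Section PreorderSpace.
Variables (T : choiceType) (le : T -> T -> Prop).
Local Notation W := (preorder_space le).

Definition down_set : set (set W) := [set U | forall x y, le x y -> U y -> U x].

Let down_setT : down_set setT. Proof. by []. Qed.

Let down_setI : setI_closed down_set.
Proof.
by move=> U V dU dV x y xy [Uy Vy]; split; [apply: dU xy _|apply: dV xy _].
Qed.

Let down_set_bigU (I : Type) (f : I -> set W) :
  (forall i, down_set (f i)) -> down_set (\bigcup_i f i).
Proof. by move=> df x y xy [i _ fy]; exists i => //; exact: df xy fy. Qed.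

HB.instance Definition _ := Choice.on W.
HB.instance Definition _ :=
  isOpenTopological.Build W down_setT down_setI down_set_bigU.

Lemma preorder_space_openE : (open : set (set W)) = down_set.
Proof. by []. Qed.

Lemma preorder_space_spec_le (x y : W) : le x y -> spec_le x y.
Proof. by move=> xy; apply/spec_leP => U oU; exact: oU xy. Qed.

Lemma preorder_space_nbhs (x : W) :
  (forall x, le x x) -> (forall x y z, le x y -> le y z -> le x z) ->
  nbhs x [set y | le y x].
Proof.
move=> le_refl le_trans; apply: open_nbhs_nbhs; split; last exact: le_refl.
by rewrite preorder_space_openE => y z yz zx; exact: le_trans yz zx.
Qed.

End PreorderSpace.

(** An open set containing [y] contains [x], so preimages of open sets are empty, [D] or
    everything. *)
Lemma jump_continuous (T X : topologicalType) (D : set T) (x y : X) :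
  open D -> spec_le x y -> continuous (fun t => if t \in D then x else y).
Proof.
move=> oD xy; apply/continuousP => O oO.
have [Oy|nOy] := pselect (O y).
  rewrite (_ : _ @^-1` _ = setT); first exact: openT.
  apply/seteqP; split=> // t _ /=; case: ifP => // _.
  exact: spec_le_open xy _ _.
have [Ox|nOx] := pselect (O x).
  rewrite (_ : _ @^-1` _ = D) //.
  apply/seteqP; split=> t /=; first by case: ifP => // /set_mem.
  by move=> Dt; rewrite mem_set.
rewrite (_ : _ @^-1` _ = set0); first exact: open0.
by apply/seteqP; split=> t //=; case: ifP.
Qed.

Lemma continuous_section_l (X Y Z : topologicalType) (G : X * Y -> Z) (y : Y) :
  continuous G -> continuous (fun x => G (x, y)).
Proof.
move=> cG x; apply: (@continuous_comp _ _ _ (fun x => (x, y)) G); last first.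
  exact: cG.
apply: (@cvg_pair _ _ _ _ (nbhs x) (nbhs y)) => /=; first exact: cvg_id.
exact: cvg_cst.
Qed.

Local Open Scope ring_scope.

Lemma nbhs_unit_interval (R : realType) (t : unit_interval R)
    (P : set (unit_interval R)) : nbhs t P ->
  exists2 d : R, 0 < d & forall s, `|set_val s - set_val t| < d -> P s.
Proof.
move=> /set_val_nbhs[V /nbhs_ballP[d d0 dV] VP]; exists d => // s sd.
by apply/VP/dV; rewrite -ball_normE /= distrC.
Qed.

Lemma unit_interval_ge0 (R : realType) (t : unit_interval R) :
  0 <= set_val t.
Proof.
by have := set_valP t; rewrite /unit_interval /= in_itv /= => /andP[].
Qed.

(** * Simultaneous lifting of a family of paths *)

Section PathFamily.
Variables (R : realType) (E B : topologicalType) (p : E -> B).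
Hypotheses (finE : finite_set [set: E]) (T0E : kolmogorov_space E).
Hypotheses (T0B : kolmogorov_space B) (np : irremovable_map p).
Hypothesis pH : hurewicz_fibration R p.

Variables (K : choiceType) (e : E) (dn up : set E).
Hypotheses (dn_le : forall x y, spec_le x y -> dn y -> dn x).
Hypotheses (up_le : forall x y, spec_le x y -> up x -> up y).
Hypotheses (dn_e : forall x, dn x -> spec_le x e).
Hypotheses (up_e : forall x, up x -> spec_le e x).
Hypotheses (dn_up : forall (k k' : K) x, dn x -> up x -> k = k').

(** Distinct added points are incomparable; [dn_up] keeps this transitive, since a point in both
    [up] and [dn] would sit between any two of them. *)
Definition adjoin_le (u v : E + K) : Prop :=
  match u, v with
  | inl x, inl y => spec_le x y
  | inl x, inr _ => dn x
  | inr _, inl y => up y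
  | inr k, inr k' => k = k'
  end.

Let W := preorder_space adjoin_le.

Let adjoin_le_refl u : adjoin_le u u.
Proof. by case: u => [x|k]; [exact: spec_le_refl|]. Qed.

Let adjoin_le_trans u v w : adjoin_le u v -> adjoin_le v w -> adjoin_le u w.
Proof.
case: u v w => [x|k] [y|l] [z|m] //=.
- by move=> xy yz; exact: spec_le_trans yz xy.
- exact: dn_le.
- by move=> dx uz; exact: spec_le_trans (up_e uz) (dn_e dx).
- by move=> uy yz; exact: up_le yz uy.
- by move=> uy dy; exact: dn_up dy uy.
- by move=> -> ->.
Qed.

Variable H : K -> unit_interval R -> B.
Hypotheses (cH : forall k, continuous (H k)).
Hypotheses (H0 : forall k, H k (ui0 R) = p e).
Hypothesis (dnH : forall k t x, dn x -> spec_le (p x) (H k t)).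
Hypotheses (upH : forall k t x, up x -> spec_le (H k t) (p x)).

Let pmono : {homo p : x y / spec_le x y}.
Proof. exact: spec_le_continuous (hurewicz_continuous pH). Qed.

Let h (u : W) : E := match u with inl x => x | inr _ => e end.

Let HW (z : W * unit_interval R) : B :=
  match z.1 with inl x => p x | inr k => H k z.2 end.

Let ch : continuous h.
Proof.
apply/continuousP => U oU; rewrite preorder_space_openE => -[x|k] [y|l] //=.
- by move=> xy; exact: spec_le_open.
- by move=> dx; exact: spec_le_open (dn_e dx) oU.
- by move=> uy; exact: spec_le_open (up_e uy) oU.
Qed.

(** [dnH] and [upH] make [HW] monotone in the point at every time, so the down-set of [u] times a
    set of times serves as neighbourhood: all times if [u] is in [E], those given by continuity of
    [H k] if [u = inr k]. *)
Let cHW : continuous HW.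
Proof.
move=> [u t] O; rewrite nbhsE => -[U [oU UHW] UO].
apply: filterS (_ : nbhs (u, t) (HW @^-1` U)) => [z /UO//|].
have nu := preorder_space_nbhs u adjoin_le_refl adjoin_le_trans.
case: u UHW nu => [x|k] Ux nu.
  exists ([set v | adjoin_le v (inl x)], setT).
    by split=> //; exact: filterT.
  move=> [[y|l] s] /= [+ _] => [yx|ux].
    exact: spec_le_open (pmono yx) oU Ux.
  exact: spec_le_open (upH ux) oU Ux.
exists ([set v | adjoin_le v (inr k)], H k @^-1` U).
  by split=> //=; apply: cH; apply: open_nbhs_nbhs.
move=> [[y|l] s] /= [+ Us] => [dy|->//].
exact: spec_le_open (dnH dy) oU Us.
Qed.

(** The bound [d] comes before [k]: it depends only on how the lift moves the finitely many points
    of [E], even when [K] is infinite. *)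
Lemma lift_path_family : exists2 d : R, 0 < d & forall k,
  exists g : unit_interval R -> E,
    (forall t, p (g t) = H k t) /\
    forall t x, set_val t < d ->
      (dn x -> spec_le x (g t)) /\ (up x -> spec_le (g t) x).
Proof.
have [|G [cG G0 pG]] := hurewicz_lifting pH ch cHW; first by case.
have Gmono u v t : adjoin_le u v -> spec_le (G (u : W, t)) (G (v : W, t)).
  move=> uv; have uvW := @preorder_space_spec_le _ adjoin_le u v uv.
  exact: (@spec_le_continuous W E _ (continuous_section_l (y := t) cG) u v uvW).
have cGt u := (continuous_curry cG).2 u.
(* At time 0 the lift at [x] is [x], whose down-set is a neighbourhood. *)
have /nbhs_unit_interval[d d0 dG] :
    nbhs (ui0 R) [set t | forall x : E, spec_le (G (inl x : W, t)) x].
  apply: filter_finite_forall => // x.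
  have := cGt (inl x) (ui0 R) _ (nbhs_spec_le (G (inl x : W, ui0 R)) finE).
  by rewrite G0.
have Gid x t : set_val t < d -> G (inl x : W, t) = x.
  move=> td.
  apply: (@irremovable_map_rigid _ _ p (fun y => G (inl y : W, t))) => //.
  - by move=> y z yz; exact: Gmono.
  - move=> y; apply: dG; rewrite /= subr0 ger0_norm //.
    exact: unit_interval_ge0.
exists d => // k; exists (fun t => G (inr k : W, t)); split.
- by move=> t; rewrite pG.
- by move=> t x td; split=> [dx|ux]; rewrite -{1}(Gid x t td); exact: Gmono.
Qed.

End PathFamily.

Lemma exists_small_unit_interval (R : realType) (d : R) : 0 < d ->
  exists t : unit_interval R, 0 < set_val t < d.
Proof.
move=> d0; have m0 : 0 < Num.min (d / 2) 1 by rewrite lt_min divr_gt0 /=.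
have mI : Num.min (d / 2) 1 \in unit_interval R.
  by rewrite inE /unit_interval /= in_itv /= (ltW m0) ge_min lexx orbT.
exists (exist (fun x => x \in unit_interval R) _ mI); rewrite m0 /= gt_min.
by rewrite ltr_pdivrMr // ltr_pMr // ltr1n.
Qed.

(** * Cartesian and opcartesian lifts *)

Section Lifts.
Variables (R : realType) (E B : topologicalType) (p : E -> B).
Hypotheses (finE : finite_set [set: E]) (T0E : kolmogorov_space E).
Hypotheses (T0B : kolmogorov_space B) (np : irremovable_map p).
Hypothesis pH : hurewicz_fibration R p.

Let pmono : {homo p : x y / spec_le x y}.
Proof. exact: spec_le_continuous (hurewicz_continuous pH). Qed.

Lemma exists_cartesian_lift (e : E) (b : B) : spec_le b (p e) ->
  exists e', [/\ spec_le e' e, p e' = b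
    & forall x, spec_le x e -> spec_le (p x) b -> spec_le x e'].
Proof.
move=> be.
(* The smaller value [b] must be taken on an open set of times, here all positive ones, so one path
   serves every [d]. *)
pose H (_ : unit) t := if t \in [set t : unit_interval R | 0 < set_val t]
  then b else p e.
have [|||||||||d d0 /(_ tt)[g [pg gd]]] := @lift_path_family R E B p finE T0E
  T0B np pH unit e [set x | spec_le x e /\ spec_le (p x) b] (spec_le e)
  _ _ _ _ _ H.
- by move=> x y xy [ye yb]; split; apply: spec_le_trans; eauto.
- by move=> x y xy ex; exact: spec_le_trans xy ex.
- by move=> x [].
- by [].
- by move=> [] [].
- move=> k; apply: jump_continuous be.
  by exists [set x | 0 < x] => //; exact: open_gt.
- by move=> k; rewrite /H; case: ifP => // /set_mem /=; rewrite ltxx.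
- move=> k t x [xe xb]; rewrite /H; case: ifP => // _; exact: pmono.
- move=> k t x ex; rewrite /H; case: ifP => // _; last exact: pmono.
  exact: spec_le_trans (pmono ex) be.
have [t /andP[t0 td]] := exists_small_unit_interval d0.
exists (g t); split.
- exact: (gd _ _ td).2.
- by rewrite pg /H mem_set.
- by move=> x xe xb; exact: (gd _ _ td).1.
Qed.

Lemma exists_opcartesian_lift (e : E) (b : B) : spec_le (p e) b ->
  exists e', [/\ spec_le e e', p e' = b
    & forall x, spec_le e x -> spec_le b (p x) -> spec_le e' x].
Proof.
(* When [p e <> b], no point is in both [dn] and [up], as infinitely many added points require. *)
move=> eb; have [<-|bNe] := pselect (p e = b).
  by exists e; split=> //; exact: spec_le_refl.
(* Now [p e] is the smaller value and holds at time 0, hence on some [[0, s[]; every [s] is included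
   because [d] is not yet known. *)
pose H (s : {posnum R}) t :=
  if t \in [set t : unit_interval R | set_val t < s%:num] then p e else b.
have [|||||||||d d0 gH] := @lift_path_family R E B p finE T0E
  T0B np pH {posnum R} e [set x | spec_le x e]
  [set x | spec_le e x /\ spec_le b (p x)] _ _ _ _ _ H.
- by move=> x y xy ye; exact: spec_le_trans ye xy.
- by move=> x y xy [ex bx]; split; [exact: spec_le_trans xy ex|
    exact: spec_le_trans (pmono xy) bx].
- by [].
- by move=> x [].
- move=> k k' x xe [ex bx]; case: bNe; apply: spec_le_anti => //.
  exact: spec_le_trans (pmono xe) bx.
- move=> s; apply: jump_continuous eb.
  by exists [set x | x < s%:num] => //; exact: open_lt.
- by move=> s; rewrite /H mem_set //=; exact: gt0.
- move=> s t x /pmono xe; rewrite /H; case: ifP => // _.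
  exact: spec_le_trans eb xe.
- by move=> s t x [/pmono ex bx]; rewrite /H; case: ifP.
have [t /andP[t0 td]] := exists_small_unit_interval d0.
(* The path jumping at time [t] itself already has value [b] there. *)
have [g [pg gd]] := gH (PosNum t0).
exists (g t); split.
- exact: (gd _ _ td).1.
- by rewrite pg /H; case: ifP => // /set_mem /=; rewrite ltxx.
- by move=> x ex bx; exact: (gd _ _ td).2.
Qed.

(** As parallel arrows are equal, being cartesian reduces to the extremality of the lifts above. *)
Lemma hurewicz_grothendieck (cp : continuous p) :
  grothendieck_bifibration (map_functor cp).
Proof.
split=> [e b be|e b eb].
  have [e' [e'e pe' le]] := exists_cartesian_lift be.
  exists e', e'e; split.
    move=> x xe xb _; have xe' : spec_le x e' by apply: le; rewrite -?pe'.
    by exists xe'; split=> [|*]; [split|];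
      exact: (@Prop_irrelevance (spec_le _ _)).
  (* Replacing [b] by [p e'] gives both arrows the same type. *)
  move: be; rewrite -pe' => be; congr (existT _ (p e') _).
  exact: (@Prop_irrelevance (spec_le _ _)).
have [e' [ee' pe' le]] := exists_opcartesian_lift eb.
exists e', ee'; split.
  move=> x ex bx _; have e'x : spec_le e' x by apply: le; rewrite -?pe'.
  by exists e'x; split=> [|*]; [split|];
      exact: (@Prop_irrelevance (spec_le _ _)).
move: eb; rewrite -pe' => eb; congr (existT _ (p e') _).
exact: (@Prop_irrelevance (spec_le _ _)).
Qed.

End Lifts.

Theorem corollary6p22 (R : realType) (E B : topologicalType) (p : E -> B)
    (finE : finite_set [set: E]) (finB : finite_set [set: B])
    (T0E : kolmogorov_space E) (T0B : kolmogorov_space B)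
    (E0 : [set: E] !=set0) (pH : hurewicz_fibration R p) :
  exists A : set E,
    smallest_dbp_retract p A /\
    grothendieck_bifibration
      (map_functor (sigL_continuous A (hurewicz_continuous pH))).
Proof.
have cp := hurewicz_continuous pH.
have [A EA nA] := exists_dbp_retract_irremovable T0B cp [set: E] finE.
exists A; split.
  by split=> // A' EA'; exact: dbp_retract_confluent EA' EA.
have [_ [r [rA rid pr rmono]]] := dbp_retract_retraction T0B cp EA.
apply: (@hurewicz_grothendieck R).
- exact: finite_set_type.
- exact: kolmogorov_space_set_type.
- exact: T0B.
- by move=> a /(removableP T0B cp); exact: nA.
- apply: (hurewicz_fibration_sigL (r := r)) => //.
  + by apply: homo_spec_continuous => // x y; exact: rmono.
  + by move=> x; exact: rA.
  + by move=> x; exact: pr.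
Qed.
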